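(* Let $n\ge 2$, let $P=(p_1,\dots,p_n)$, $Q=(q_1,\dots,q_n)\in\Gamma_n$, and let $r,R$ be real numbers with $0<r\le \frac{p_i}{q_i}\le R<\infty$ for all $i\in\{1,\dots,n\}$. Then for every real $s\le -1$, $$\frac{1}{2r^s(r+1)}\,\Phi_s(P\|Q)\ \le\ G(P\|Q)\ \le\ \frac{1}{2R^s(R+1)}\,\Phi_s(P\|Q),$$ and for every real $s\ge 0$, $$\frac{1}{2R^s(R+1)}\,\Phi_s(P\|Q)\ \le\ G(P\|Q)\ \le\ \frac{1}{2r^s(r+1)}\,\Phi_s(P\|Q).$$
   Context: For $n\ge2$, $\Gamma_n=\{P=(p_1,\dots,p_n): p_i>0,\ \sum_{i=1}^n p_i=1\}$. For $P,Q\in\Gamma_n$ and $s\in\mathbb{R}$, the relative information of type $s$ is $\Phi_s(P\|Q)=[s(s-1)]^{-1}\left[\sum_{i=1}^n p_i^s q_i^{1-s}-1\right]$ for $s\ne 0,1$; $\Phi_0(P\|Q)=\sum_{i=1}^n q_i\ln\frac{q_i}{p_i}$; $\Phi_1(P\|Q)=\sum_{i=1}^n p_i\ln\frac{p_i}{q_i}$. The relative AG-divergence is $G(P\|Q)=\sum_{i=1}^n \left(\frac{p_i+q_i}{2}\right)\ln\left(\frac{p_i+q_i}{2p_i}\right)$. *)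

(* Defs.v *)
From HB Require Import structures.
From mathcomp Require Import all_boot all_order all_algebra.
From mathcomp Require Import all_classical all_reals all_analysis.

Set Implicit Arguments.
Unset Strict Implicit.
Unset Printing Implicit Defensive.

Import Order.TTheory GRing.Theory Num.Theory.

Local Open Scope classical_set_scope.
Local Open Scope ring_scope.

Definition Gamma (K : realType) (n : nat) : set ('I_n -> K) :=
  [set P | (forall i, 0 < P i) /\ \sum_(i < n) P i = 1].
Arguments Gamma : clear implicits.

(* [Phi_s(P || Q)]: the values at 0 and 1 are the limits of the generic formula.
   Outside [Gamma] the result depends on the conventions of [ln] and [`^]. *)
Definition relative_information (K : realType) (n : nat) (s : K)
    (P Q : 'I_n -> K) : K :=
  if s == 0 then \sum_(i < n) Q i * ln (Q i / P i)
  else if s == 1 then \sum_(i < n) P i * ln (P i / Q i)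
  else (s * (s - 1))^-1 * (\sum_(i < n) P i `^ s * Q i `^ (1 - s) - 1).

Definition AG_divergence (K : realType) (n : nat) (P Q : 'I_n -> K) : K :=
  \sum_(i < n) (P i + Q i) / 2 * ln ((P i + Q i) / (2 * P i)).

(* Main.v *)
Require Import Defs.
From HB Require Import structures.
From mathcomp Require Import all_boot all_order all_algebra.
From mathcomp Require Import all_classical all_reals all_analysis.
From mathcomp Require Import ring lra.

(** Both divergences are Csiszar divergences [\sum_i Q i * f (P i / Q i)]: the
    generator of [Phi_s] has second derivative [x^(s-2)], that of the relative
    AG-divergence has second derivative [1 / (2 x^2 (x + 1))], and both vanish
    at 1.

    Comparing two such divergences only takes a comparison of the second
    derivatives on [[r, R]] ([le_f_divergence]).  Indeed, if [h] is the
    difference of the generators and [h'' >= 0], then [h] lies above its tangent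
    at 1, which passes through 0 there; and the tangent line contributes nothing
    to the weighted sum, since [\sum_i Q i * (P i / Q i - 1) = 1 - 1 = 0].  The
    point 1 belongs to [[r, R]] because it is the [Q]-average of the ratios
    ([ratio_bounds_around1]).

    The quotient of the second derivative of the generator of [Phi_s] by that of
    the AG generator is [weight s x = 2 x^s (x + 1)].  So every upper bound [b]
    of the weight on [[r, R]] gives [Phi_s / b <= G], and every positive lower
    bound [b] gives [G <= Phi_s / b] ([info_le_AG], [AG_le_info]).  The weight
    is nondecreasing for [s >= 0]; written as [2 (x^(s+1) + x^s)] it is
    nonincreasing for [s <= -1], where both exponents are nonpositive.  Its
    extreme values are thus attained at [r] and [R], which gives the four
    bounds. *)

Set Implicit Arguments.
Unset Strict Implicit.
Unset Printing Implicit Defensive.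

Import Order.TTheory GRing.Theory Num.Theory.

Local Open Scope classical_set_scope.
Local Open Scope ring_scope.

(** * Convexity through second derivatives *)

(** In this form the mean value theorem does not ask which of [x] and [y] is
    larger: that [c] lies on the same side of [x] as [y] is a sign condition,
    which [above_tangent] multiplies by the second derivative. *)
Lemma mean_value_between (K : realType) (f df : K -> K) (a b x y : K) :
  (forall z, a <= z <= b -> is_derive z 1 f (df z)) ->
  a <= x <= b -> a <= y <= b ->
  exists c, [/\ a <= c <= b, 0 <= (c - x) * (y - x) &
                f y - f x = df c * (y - x)].
Proof.
move=> fD.
have mvt u v : a <= u -> u <= v -> v <= b ->
    exists2 c, u <= c <= v & f v - f u = df c * (v - u).
  move=> au uv vb.
  have D z : u <= z <= v -> is_derive z 1 f (df z).
    by move=> /andP[uz zv]; apply: fD; rewrite (le_trans au uz) (le_trans zv vb).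
  have [z||c] := @MVT_segment K f df u v uv.
  - by rewrite in_itv/= => /andP[uz zv]; apply: D; rewrite !ltW.
  - apply: derivable_within_continuous => z.
    by rewrite in_itv/= => /D zD; apply: ex_derive.
  - by rewrite in_itv/=; exists c.
move=> /andP[ax xb] /andP[ay yb]; have [xy|/ltW yx] := leP x y.
- have [c /andP[xc cy] fc] := mvt x y ax xy yb.
  exists c; split=> //; first by rewrite (le_trans ax xc) (le_trans cy yb).
  by rewrite mulr_ge0// subr_ge0.
- have [c /andP[yc cx] fc] := mvt y x ay yx xb.
  exists c; split; first by rewrite (le_trans ay yc) (le_trans cx xb).
  + by rewrite mulr_le0// subr_le0.
  + by rewrite -opprB fc -mulrN opprB.
Qed.

(** Two applications of the mean value theorem give
    [f y = f x + df x * (y - x) + ddf d * (c - x) * (y - x)] with [c] between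
    [x] and [y], so that the remainder has the sign of [ddf d]. *)
Lemma above_tangent (K : realType) (f df ddf : K -> K) (a b x y : K) :
  (forall z, a <= z <= b -> is_derive z 1 f (df z)) ->
  (forall z, a <= z <= b -> is_derive z 1 df (ddf z)) ->
  (forall z, a <= z <= b -> 0 <= ddf z) ->
  a <= x <= b -> a <= y <= b ->
  f x + df x * (y - x) <= f y.
Proof.
move=> fD dfD ddf_ge0 xab yab.
have [c [cab cxy fc]] := mean_value_between fD xab yab.
have [d [dab _ dfd]] := mean_value_between dfD xab cab.
have -> : f y = f x + df x * (y - x) + ddf d * ((c - x) * (y - x)).
  by rewrite mulrA -dfd -[LHS](subrK (f x)) fc; ring.
by rewrite lerDl mulr_ge0// ddf_ge0.
Qed.

(** * Comparison of Csiszar divergences *)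

Definition f_divergence (K : realType) (n : nat) (f : K -> K)
    (P Q : 'I_n -> K) : K :=
  \sum_(i < n) Q i * f (P i / Q i).

(** Both [P] and [Q] have total mass 1, so the ratios [P i / Q i] cannot all be
    above 1, nor all below 1. *)
Lemma ratio_bounds_around1 (K : realType) (n : nat) (P Q : 'I_n -> K) (r R : K) :
  Gamma K n P -> Gamma K n Q -> (forall i, r <= P i / Q i <= R) ->
  r <= 1 <= R.
Proof.
move=> [_ sP] [Q0 sQ] rR; apply/andP; split.
- rewrite -[r]mulr1 -{1}sQ -sP mulr_sumr ler_sum// => i _.
  by rewrite -ler_pdivlMr//; case/andP: (rR i).
- rewrite -[R]mulr1 -{1}sP -sQ mulr_sumr ler_sum// => i _.
  by rewrite -ler_pdivrMr//; case/andP: (rR i).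
Qed.

(** The difference [g - f] is above its tangent at 1, which is the line
    [(dg 1 - df 1) * (x - 1)]; the [Q]-weighted sum of this line over the ratios
    is a multiple of [\sum_i (P i - Q i) = 0]. *)
Lemma le_f_divergence (K : realType) (n : nat) (P Q : 'I_n -> K) (r R : K)
    (f df ddf g dg ddg : K -> K) :
  Gamma K n P -> Gamma K n Q -> (forall i, r <= P i / Q i <= R) ->
  (forall x, r <= x <= R -> is_derive x 1 f (df x)) ->
  (forall x, r <= x <= R -> is_derive x 1 df (ddf x)) ->
  (forall x, r <= x <= R -> is_derive x 1 g (dg x)) ->
  (forall x, r <= x <= R -> is_derive x 1 dg (ddg x)) ->
  (forall x, r <= x <= R -> ddf x <= ddg x) ->
  f 1 = g 1 ->
  f_divergence f P Q <= f_divergence g P Q.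
Proof.
move=> hP hQ rR fD dfD gD dgD fg fg1.
have r1R := ratio_bounds_around1 hP hQ rR.
have [_ sP] := hP; have [Q0 sQ] := hQ.
have tangent i :
    (dg 1 - df 1) * (P i - Q i) <= Q i * g (P i / Q i) - Q i * f (P i / Q i).
  have Qi0 : Q i != 0 by rewrite gt_eqF.
  rewrite -mulrBr.
  have -> : (dg 1 - df 1) * (P i - Q i) =
            Q i * ((g - f) 1 + (dg - df) 1 * (P i / Q i - 1)).
    by rewrite !fctE fg1 subrr add0r; field.
  apply: ler_wpM2l; first exact: ltW.
  apply: (@above_tangent K (g - f) (dg - df) (ddg - ddf) r R) => // x xrR.
  - by have := fD x xrR; have := gD x xrR => ? ?; apply: is_deriveB.
  - by have := dfD x xrR; have := dgD x xrR => ? ?; apply: is_deriveB.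
  - by rewrite !fctE subr_ge0 fg.
rewrite -subr_ge0 /f_divergence -sumrB.
apply: le_trans (ler_sum _ (fun i _ => tangent i)).
by rewrite -mulr_sumr sumrB sP sQ subrr mulr0.
Qed.

(** * The two generators *)

Definition info_gen (K : realType) (s x : K) : K :=
  if s == 0 then - ln x
  else if s == 1 then x * ln x
  else (s * (s - 1))^-1 * (x `^ s - 1).

(** At [s = 0] the general formula already gives [- x^-1], the derivative of
    [- ln x], so only [s = 1] is exceptional. *)
Definition info_gen' (K : realType) (s x : K) : K :=
  if s == 1 then ln x + 1 else (s - 1)^-1 * x `^ (s - 1).

(** The logarithm of [(x + 1) / (2 x)] is split, which makes the generator and
    its derivative sums of functions differentiable on the positive half-line. *)
Definition ag_gen (K : realType) (x : K) : K :=
  (x + 1) / 2 * (ln (x + 1) - ln 2 - ln x).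

Definition ag_gen' (K : realType) (x : K) : K :=
  2^-1 * (ln (x + 1) - ln 2 - ln x - x^-1).

Lemma relative_informationE (K : realType) (n : nat) (P Q : 'I_n -> K) (s : K) :
  Gamma K n P -> Gamma K n Q ->
  relative_information s P Q = f_divergence (info_gen s) P Q.
Proof.
move=> [P0 _] [Q0 sQ]; rewrite /relative_information /f_divergence /info_gen.
case: eqVneq => [_|s0].
  apply: eq_bigr => i _.
  by rewrite -[Q i / P i]invf_div lnV// posrE divr_gt0.
case: eqVneq => [_|s1].
  by apply: eq_bigr => i _; rewrite mulrA mulrCA divff ?mulr1// gt_eqF.
(* The constant 1 is distributed over the indices as the total mass of [Q]. *)
rewrite -[X in _ * (_ - X)]sQ -sumrB mulr_sumr; apply: eq_bigr => i _.
have Qi0 : Q i != 0 by rewrite gt_eqF.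
rewrite mulrCA; congr (_ * _); rewrite mulrBr mulr1; congr (_ - _).
rewrite powRM ?invr_ge0 ?ltW// -powR_inv1 ?ltW// -powRrM mulN1r mulrCA.
by rewrite powRD ?Qi0 ?implybT// powRr1 ?ltW.
Qed.

Lemma AG_divergenceE (K : realType) (n : nat) (P Q : 'I_n -> K) :
  Gamma K n P -> Gamma K n Q ->
  AG_divergence P Q = f_divergence (@ag_gen K) P Q.
Proof.
move=> [P0 _] [Q0 _]; apply: eq_bigr => i _; rewrite /ag_gen.
have Pi := P0 i; have Qi := Q0 i.
have PQi : 0 < P i / Q i by rewrite divr_gt0.
rewrite -!ln_div ?posrE ?divr_gt0// ?addr_gt0//.
rewrite mulrA; congr (_ * ln _).
- by field; rewrite gt_eqF.
- by field; rewrite !gt_eqF.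
Qed.

Lemma is_derive_info_gen (K : realType) (s x : K) :
  0 < x -> is_derive x 1 (info_gen s) (info_gen' s x).
Proof.
move=> x0; have xn0 : x != 0 by rewrite gt_eqF.
have lnD := is_derive1_ln x0; have powD := is_derive1_powR s x0.
rewrite /info_gen /info_gen'; case: (eqVneq s 0) => [->|s0].
  rewrite eq_sym oner_eq0 sub0r powR_inv1 ?ltW//.
  by apply: is_derive_eq; rewrite invrN1 mulN1r.
case: (eqVneq s 1) => [_|s1].
  have -> : (fun y : K => y * ln y) = id * @ln K by [].
  by apply: is_derive_eq; rewrite /GRing.scale/= mulfV// mulr1 addrC.
have -> : (fun y : K => (s * (s - 1))^-1 * (y `^ s - 1)) =
          (s * (s - 1))^-1 \*: ((@powR K)^~ s - cst 1) by [].
apply: is_derive_eq; rewrite subr0 /GRing.scale/=.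
by field; rewrite subr_eq0 s0 s1.
Qed.

Lemma is_derive_info_gen' (K : realType) (s x : K) :
  0 < x -> is_derive x 1 (info_gen' s) (x `^ s / x ^+ 2).
Proof.
move=> x0; have xn0 : x != 0 by rewrite gt_eqF.
have lnD := is_derive1_ln x0; have powD := is_derive1_powR (s - 1) x0.
rewrite /info_gen'; case: (eqVneq s 1) => [->|s1].
  have -> : (fun y : K => ln y + 1) = @ln K + cst 1 by [].
  by apply: is_derive_eq; rewrite addr0 powRr1 ?ltW//; field.
have -> : (fun y : K => (s - 1)^-1 * y `^ (s - 1)) =
          (s - 1)^-1 \*: (@powR K)^~ (s - 1) by [].
apply: is_derive_eq; rewrite /GRing.scale/= mulKf ?subr_eq0//.
have -> : s - 1 - 1 = s - 2%:R by ring.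
by rewrite powRB ?xn0 ?implybT// powR_mulrn// ltW.
Qed.

Lemma is_derive_ln_shift (K : realType) (x : K) :
  0 < x -> is_derive x 1 (fun y : K => ln (y + 1)) (x + 1)^-1.
Proof.
move=> x0; have lnD : is_derive (x + 1) 1 (@ln K) (x + 1)^-1.
  by apply: is_derive1_ln; rewrite addr_gt0.
have shD : is_derive x 1 (fun y : K => y + 1) (1 + 0).
  by have -> : (fun y : K => y + 1) = id + cst 1 by []; apply: is_deriveD.
have := @is_derive1_comp K (@ln K) (fun y => y + 1) x _ _ lnD shD.
by rewrite addr0 mulr1.
Qed.

Lemma is_derive_ag_gen (K : realType) (x : K) :
  0 < x -> is_derive x 1 (@ag_gen K) (ag_gen' x).
Proof.
move=> x0; have xn0 : x != 0 by rewrite gt_eqF.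
have x1n0 : x + 1 != 0 by rewrite gt_eqF ?addr_gt0.
have lnD := is_derive1_ln x0; have ln1D := is_derive_ln_shift x0.
have halfD : is_derive x 1 (fun y : K => (y + 1) / 2) 2^-1.
  have -> : (fun y : K => (y + 1) / 2) = 2^-1 \*: ((@id K) + cst 1).
    by apply/funext => y; rewrite !fctE mulrC.
  by apply: is_derive_eq; rewrite addr0 /GRing.scale/= mulr1.
have logD : is_derive x 1 (fun y : K => ln (y + 1) - ln 2 - ln y)
    ((x + 1)^-1 - x^-1).
  have -> : (fun y : K => ln (y + 1) - ln 2 - ln y) =
            (fun y : K => ln (y + 1)) - cst (ln 2) - @ln K by [].
  by apply: is_derive_eq; rewrite subr0.
have agD := is_deriveM halfD logD.
apply: (is_derive_eq agD); rewrite /ag_gen' /GRing.scale/=.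
by field; rewrite xn0 x1n0.
Qed.

Lemma is_derive_ag_gen' (K : realType) (x : K) :
  0 < x -> is_derive x 1 (@ag_gen' K) (2 * x ^+ 2 * (x + 1))^-1.
Proof.
move=> x0; have xn0 : x != 0 by rewrite gt_eqF.
have x1n0 : x + 1 != 0 by rewrite gt_eqF ?addr_gt0.
have lnD := is_derive1_ln x0; have ln1D := is_derive_ln_shift x0.
have invD : is_derive x 1 (fun y : K => y^-1) (- x ^- 2).
  by apply: is_derive_eq; [apply: is_deriveV | rewrite /GRing.scale/= mulr1].
have -> : @ag_gen' K = 2^-1 \*:
            ((fun y => ln (y + 1)) - cst (ln 2) - @ln K - (fun y => y^-1)).
  by [].
apply: is_derive_eq; rewrite /GRing.scale/=.
by field; rewrite xn0 x1n0.
Qed.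

(** * The quotient of the second derivatives *)

Definition weight (K : realType) (s x : K) : K := 2 * x `^ s * (x + 1).

Lemma weight_gt0 (K : realType) (s x : K) : 0 < x -> 0 < weight s x.
Proof. by move=> x0; rewrite !mulr_gt0 ?powR_gt0 ?addr_gt0. Qed.

Lemma weight_quotient (K : realType) (s x : K) : 0 < x ->
  (x `^ s / x ^+ 2) = weight s x * (2 * x ^+ 2 * (x + 1))^-1.
Proof.
move=> x0; rewrite /weight; field.
by rewrite !gt_eqF ?addr_gt0.
Qed.

Lemma weight_nondecreasing (K : realType) (s x y : K) :
  0 <= s -> 0 < x -> x <= y -> weight s x <= weight s y.
Proof.
move=> s0 x0 xy; have y0 := lt_le_trans x0 xy.
apply: ler_pM.
- by rewrite mulr_ge0// powR_ge0.
- by rewrite addr_ge0// ltW.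
- by rewrite ler_pM2l// ge0_ler_powR// nnegrE ltW.
- by rewrite lerD2r.
Qed.

Lemma le0_ler_powR (K : realType) (s x y : K) :
  s <= 0 -> 0 < x -> x <= y -> y `^ s <= x `^ s.
Proof.
move=> s0 x0 xy; have y0 := lt_le_trans x0 xy.
rewrite -[s]opprK !(powRN _ (- s)) lef_pV2 ?posrE ?powR_gt0//.
by rewrite ge0_ler_powR ?nnegrE ?oppr_ge0// ltW.
Qed.

(** In the product [x^s * (x + 1)] the factors vary in opposite directions; in
    [x^(s+1) + x^s] both terms are nonincreasing as soon as [s + 1 <= 0]. *)
Lemma weight_nonincreasing (K : realType) (s x y : K) :
  s <= -1 -> 0 < x -> x <= y -> weight s y <= weight s x.
Proof.
move=> s1 x0 xy; have y0 := lt_le_trans x0 xy.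
have weightE (z : K) : 0 < z -> weight s z = 2 * (z `^ (s + 1) + z `^ s).
  by move=> z0; rewrite /weight powRD ?(gt_eqF z0) ?implybT// powRr1 ?ltW//; ring.
rewrite !weightE// ler_pM2l// lerD// le0_ler_powR//; lra.
Qed.

(** * Bounds on the AG-divergence from bounds on the weight *)

Section comparison.
Context (K : realType) (n : nat) (P Q : 'I_n -> K) (r R s : K).
Hypotheses (hP : Gamma K n P) (hQ : Gamma K n Q) (r0 : 0 < r).
Hypothesis hrR : forall i, r <= P i / Q i <= R.

Let pos x : r <= x <= R -> 0 < x.
Proof. by case/andP => rx _; exact: lt_le_trans rx. Qed.

Let scaled_info_derive c x : r <= x <= R ->
  is_derive x 1 (c \*: info_gen s) ((c \*: info_gen' s) x) *
  is_derive x 1 (c \*: info_gen' s) (c * (x `^ s / x ^+ 2)).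
Proof.
move=> /pos x0; have := is_derive_info_gen s x0.
by have := is_derive_info_gen' s x0 => ? ?; split; apply: is_deriveZ.
Qed.

Let scaled_infoE c :
  c * relative_information s P Q = f_divergence (c \*: info_gen s) P Q.
Proof.
rewrite relative_informationE// /f_divergence mulr_sumr.
by apply: eq_bigr => i _; rewrite mulrCA.
Qed.

Let gens_at1 c : (c \*: info_gen s) 1 = ag_gen (1 : K).
Proof.
rewrite /ag_gen /info_gen /= ln1 subr0 subrr mulr0 powR1 subrr mulr0 oppr0 mulr0.
by case: ifP => _; [|case: ifP => _]; rewrite scaler0.
Qed.

(** The scaled generator [b^-1 * info_gen s] has second derivative
    [weight s x / b] times that of [ag_gen], a factor at most 1 on [[r, R]]. *)
Lemma info_le_AG b : 0 < b -> (forall x, r <= x <= R -> weight s x <= b) ->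
  b^-1 * relative_information s P Q <= AG_divergence P Q.
Proof.
move=> b0 wb; rewrite scaled_infoE AG_divergenceE//.
apply: (le_f_divergence hP hQ hrR) => [x xrR|x xrR|x xrR|x xrR|x xrR|].
- exact: (scaled_info_derive b^-1 xrR).1.
- exact: (scaled_info_derive b^-1 xrR).2.
- exact: is_derive_ag_gen (pos xrR).
- exact: is_derive_ag_gen' (pos xrR).
- have x0 := pos xrR; rewrite /= weight_quotient// [leLHS]mulrA ler_piMl//.
    by rewrite invr_ge0 !mulr_ge0 ?addr_ge0 ?ltW.
  by rewrite mulrC ler_pdivrMr// mul1r wb.
- exact: gens_at1.
Qed.

Lemma AG_le_info b : 0 < b -> (forall x, r <= x <= R -> b <= weight s x) ->
  AG_divergence P Q <= b^-1 * relative_information s P Q.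
Proof.
move=> b0 wb; rewrite scaled_infoE AG_divergenceE//.
apply: (le_f_divergence hP hQ hrR) => [x xrR|x xrR|x xrR|x xrR|x xrR|].
- exact: is_derive_ag_gen (pos xrR).
- exact: is_derive_ag_gen' (pos xrR).
- exact: (scaled_info_derive b^-1 xrR).1.
- exact: (scaled_info_derive b^-1 xrR).2.
- have x0 := pos xrR; rewrite /= weight_quotient// [leRHS]mulrA ler_peMl//.
    by rewrite invr_ge0 !mulr_ge0 ?addr_ge0 ?ltW.
  by rewrite mulrC ler_pdivlMr// mul1r wb.
- by rewrite gens_at1.
Qed.

End comparison.

Theorem theorem4p5 (K : realType) (n : nat) (hn : (2 <= n)%N)
    (P Q : 'I_n -> K) (hP : Gamma K n P) (hQ : Gamma K n Q)
    (r R : K) (hr : 0 < r) (hrR : forall i : 'I_n, r <= P i / Q i <= R) :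
  (forall s : K, s <= -1 ->
     1 / (2 * r `^ s * (r + 1)) * relative_information s P Q
       <= AG_divergence P Q
       <= 1 / (2 * R `^ s * (R + 1)) * relative_information s P Q)
  /\
  (forall s : K, 0 <= s ->
     1 / (2 * R `^ s * (R + 1)) * relative_information s P Q
       <= AG_divergence P Q
       <= 1 / (2 * r `^ s * (r + 1)) * relative_information s P Q).
Proof.
have /andP[_ R1] := ratio_bounds_around1 hP hQ hrR.
have R0 : 0 < R by apply: lt_le_trans R1.
split=> s hs; rewrite !div1r; apply/andP; split.
- apply: (info_le_AG hP hQ hr hrR); first exact: (weight_gt0 s hr).
  by move=> x /andP[rx _]; apply: weight_nonincreasing.
- apply: (AG_le_info hP hQ hr hrR); first exact: (weight_gt0 s R0).
  move=> x /andP[rx xR]; apply: weight_nonincreasing => //.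
  exact: lt_le_trans rx.
- apply: (info_le_AG hP hQ hr hrR); first exact: (weight_gt0 s R0).
  move=> x /andP[rx xR]; apply: weight_nondecreasing => //.
  exact: lt_le_trans rx.
- apply: (AG_le_info hP hQ hr hrR); first exact: (weight_gt0 s hr).
  by move=> x /andP[rx _]; apply: weight_nondecreasing.
Qed.
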